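(* Let $k\ge 1$ and let $H(k)$ be the half graph with color classes $\{u_1,\ldots,u_k\}$ and $\{v_1,\ldots,v_k\}$, where $u_i\sim v_j$ if and only if $j\le k-i+1$. Let $(a_1,\ldots,a_6)=(1,0,-1,-1,0,1)$ and define $\mathbf{x}=(x_1,\ldots,x_k)$ by $x_i=a_s$ whenever $i\equiv s \pmod 6$, $1\le s\le 6$. Let $\mathbf{y}$ be the vector on $V(H(k))$ with $\mathbf{y}(u_i)=\mathbf{y}(v_i)=x_i$ for $i=1,\ldots,k$. Then $\mathbf{y}$ is an eigenvector of the adjacency matrix of $H(k)$ for eigenvalue $1$ if $k\equiv 1\pmod 6$, and it is an eigenvector for eigenvalue $-1$ if $k\equiv 4\pmod 6$.
   Context: Graphs are simple and undirected; the adjacency matrix $A(G)$ has $(i,j)$-entry $1$ if the $i$-th and $j$-th vertices are adjacent and $0$ otherwise. The half graph $H(k)$ is as defined in the claim. *)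

(* Defs.v *)
From mathcomp Require Import all_boot all_order all_algebra.

Set Implicit Arguments.
Unset Strict Implicit.
Unset Printing Implicit Defensive.

Import Order.TTheory GRing.Theory Num.Theory.
Local Open Scope ring_scope.

Record sgraph := SGraph {
  svertex :> finType;
  adj : rel svertex;
  adj_sym : symmetric adj;
  adj_irrefl : irreflexive adj
}.

(* The vertices are numbered by their canonical enumeration [enum_val]. *)
Definition adjmx (R : pzRingType) (G : sgraph) : 'M[R]_#|G| :=
  \matrix_(i, j) (adj (enum_val i) (enum_val j))%:R.

Definition vertex_col (R : Type) (G : sgraph) (y : G -> R) : 'cV[R]_#|G| :=
  \col_i y (enum_val i).

(* MathComp's [eigenspace] is about row vectors; here A acts on columns. *)
Definition is_eigenvector (F : fieldType) (n : nat) (A : 'M[F]_n) (a : F)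
    (v : 'cV[F]_n) : Prop :=
  v != 0 /\ A *m v = a *: v.

(* For i : 'I_k, [inl i] is u_(i+1) and [inr i] is v_(i+1).  The subtraction
   is never truncated, since i.+1 <= k. *)
Definition half_adj (k : nat) : rel ('I_k + 'I_k) := fun p q =>
  match p, q with
  | inl i, inr j | inr j, inl i => (j.+1 <= k - i.+1 + 1)%N
  | _, _ => false
  end.

Lemma half_adj_sym k : symmetric (@half_adj k).
Proof. by case=> i [] j. Qed.

Lemma half_adj_irrefl k : irreflexive (@half_adj k).
Proof. by case. Qed.

Definition half_graph (k : nat) : sgraph :=
  SGraph (@half_adj_sym k) (@half_adj_irrefl k).

(* The entry of index s-1 is a_s. *)
Definition aseq (R : pzRingType) : seq R := [:: 1; 0; -1; -1; 0; 1].

(* x_i for i >= 1. *)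
Definition xval (R : pzRingType) (i : nat) : R := (aseq R)`_(i.-1 %% 6).

Lemma xvalE (R : pzRingType) (i s : nat) : (1 <= i)%N -> (1 <= s <= 6)%N ->
  (i = s %[mod 6])%N -> xval R i = (aseq R)`_s.-1.
Proof.
case: i s => [|i] [|s] // _ lts /eqP.
rewrite -(addn1 i) -(addn1 s) eqn_modDr !addn1 /xval /= => /eqP ->.
by rewrite modn_small.
Qed.

Definition yvec (R : pzRingType) (k : nat) (p : half_graph k) : R :=
  match p with inl i | inr i => xval R i.+1 end.

(* Main.v *)
Require Import Defs.
From mathcomp Require Import all_boot all_order all_algebra.
From mathcomp Require Import zify.

Set Implicit Arguments.
Unset Strict Implicit.
Unset Printing Implicit Defensive.

Import Order.TTheory GRing.Theory Num.Theory.
Local Open Scope ring_scope.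

(** The neighbours of u_i are v_1, ..., v_{k-i+1}, and symmetrically for v_i, so
    A y takes at u_i and v_i the value S(k-i+1), where S(n) = x_1 + ... + x_n.
    The six terms a_s sum to 0, so S has period 6, with values 0, 1, 1, 0, -1, -1
    at n = 0, ..., 5.  Comparing residues gives S(k-i+1) = x_i when k = 1 mod 6
    and S(k-i+1) = - x_i when k = 4 mod 6. *)

(** Reindexing along [enum_val] removes the vertex numbering. *)
Lemma adjmx_mul_vertex_col (R : pzRingType) (G : sgraph) (y : G -> R) :
  adjmx R G *m vertex_col y = vertex_col (fun p => \sum_(q | adj p q) y q).
Proof.
apply/colP => i; rewrite !mxE [RHS]big_mkcond (reindex (@enum_val G G)) /=.
  by apply: eq_bigr => j _; rewrite !mxE mulr_natl mulrb.
exact: onW_bij (@enum_val_bij G).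
Qed.

Lemma xval_sum (R : pzRingType) (n : nat) :
  \sum_(j < n) xval R j.+1 = [:: 0; 1; 1; 0; -1; -1]`_(n %% 6).
Proof.
elim: n => [|n IHn]; first by rewrite big_ord0.
(* Everything now depends on n mod 6 only. *)
rewrite big_ord_recr /= IHn /xval /= -[n.+1]addn1 -modnDml.
by have := ltn_pmod n (isT : 0 < 6)%N;
   case: (n %% 6)%N => [|[|[|[|[|[|?]]]]]] //= _;
   rewrite ?addr0 ?add0r ?subrr ?addNr.
Qed.

Lemma half_adj_sum (R : pzRingType) (k : nat) (p : half_graph k) :
  \sum_(q | adj p q) yvec R q
  = \sum_(j < k - (match p with inl i | inr i => i end)) xval R j.+1.
Proof.
rewrite big_mkcond big_sumType /=.
(* The vertex's own colour class contributes 0. As [i] counts from 0, k - i neighbours remain. *)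
case: p => i /=; rewrite big1_eq ?add0r ?addr0 -big_mkcond /=;
  rewrite (big_ord_widen _ (fun j => xval R j.+1) (leq_subr i k));
  by apply: eq_bigl => j; have := ltn_ord i; have := ltn_ord j; lia.
Qed.

Lemma half_graph_eigenvector (R : numFieldType) (k : nat) (a : R) :
  (0 < k)%N ->
  (forall i, (i < k)%N -> \sum_(j < k - i) xval R j.+1 = a * xval R i.+1) ->
  is_eigenvector (adjmx R (half_graph k)) a (vertex_col (@yvec R k)).
Proof.
move=> k_gt0 sum_x; split.
  (* The entry at u_1 is a_1 = 1, so the vector is nonzero. *)
  apply/eqP => /colP/(_ (enum_rank (inl (Ordinal k_gt0) : half_graph k))).
  by rewrite !mxE enum_rankK; apply/eqP/oner_neq0.
rewrite adjmx_mul_vertex_col; apply/colP => p; rewrite !mxE half_adj_sum.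
by case: (enum_val p) => i; apply: sum_x.
Qed.

Theorem theorem3p4 (R : numFieldType) (k : nat) (k_gt0 : (1 <= k)%N) :
  ((k = 1 %[mod 6])%N ->
     is_eigenvector (adjmx R (half_graph k)) 1 (vertex_col (@yvec R k))) /\
  ((k = 4 %[mod 6])%N ->
     is_eigenvector (adjmx R (half_graph k)) (- 1) (vertex_col (@yvec R k))).
Proof.
split=> k_mod; apply: half_graph_eigenvector => // i lt_ik;
  rewrite xval_sum /xval /= ?mulN1r ?mul1r;
  (* Writing k = (k - i) + i, the residue of k rules out all but six of the 36 pairs of residues of
     i and k - i. *)
  move: k_mod; rewrite -{1}(subnK (ltnW lt_ik)) -modnDm;
  have := ltn_pmod (k - i) (isT : 0 < 6)%N; have := ltn_pmod i (isT : 0 < 6)%N;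
  case: (i %% 6)%N => [|[|[|[|[|[|?]]]]]] // _;
  case: ((k - i) %% 6)%N => [|[|[|[|[|[|?]]]]]] //= _ _;
  by rewrite ?oppr0 ?opprK.
Qed.
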